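(* Let $n\ge 0$ and let $d\mu$ be a probability measure on the unit circle $S^1\subset\mathbb{C}$ such that either (i) the support of $d\mu$ is finite and consists of $N\ge n+1$ points, or (ii) the Verblunsky coefficients of $d\mu$ are periodic with minimal period $p\ge n+1$, $p$ even. Let $\{\cdot,\cdot\}$ denote the Poisson bracket in the Verblunsky coefficients corresponding to case (i) or (ii), as appropriate. Then the monic orthogonal polynomials $\Phi_n$ and second kind polynomials $\Psi_n$, together with their reversed polynomials $\Phi_n^*,\Psi_n^*$, regarded as functions of the Verblunsky coefficients, satisfy for all $z\neq w$ in $\mathbb{C}$: $$\{\Phi_n(z),\Phi_n(w)\}=\{\Psi_n(z),\Psi_n(w)\}=0,$$ $$\{\Phi_n(z),\Phi^*_n(w)\}=\frac{iw}{z-w}\bigl(\Phi_n(z)\Phi_n^*(w)-\Phi_n(w)\Phi_n^*(z)\bigr),$$ $$\{\Psi_n(z),\Psi_n^*(w)\}=\frac{iw}{z-w}\bigl(\Psi_n(z)\Psi_n^*(w)-\Psi_n(w)\Psi_n^*(z)\bigr),$$ $$\{\Phi_n(z),\Psi_n(w)\}=\frac{-iw}{z-w}\bigl(\Phi_n(z)\Psi_n(w)-\Phi_n(w)\Psi_n(z)\bigr)-\frac{i}{2}\bigl(\Phi_n(z)-\Psi_n(z)\bigr)\bigl(\Phi_n(w)+\Psi_n(w)\bigr),$$ $$\{\Phi_n(z),\Psi_n^*(w)\}=\frac{-iw}{z-w}\bigl(\Psi_n(z)\Phi^*_n(w)-\Psi_n(w)\Phi^*_n(z)\bigr)+\fr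ac{i}{2}\bigl(\Phi_n(z)-\Psi_n(z)\bigr)\bigl(\Phi_n^*(w)-\Psi_n^*(w)\bigr).$$
   Context: Let $\mathbb{D}=\{z\in\mathbb{C}: |z|<1\}$. A probability measure $d\mu$ on $S^1$ has Verblunsky coefficients $\alpha_k$, defined by the recurrence for its monic orthogonal polynomials: $\Phi_0=\Phi_0^*=1$, $$\Phi_{k+1}(z)=z\Phi_k(z)-\bar\alpha_k\Phi_k^*(z),\qquad \Phi_{k+1}^*(z)=\Phi_k^*(z)-\alpha_k z\Phi_k(z),$$ where $\Phi_k^*(z)=z^k\,\overline{\Phi_k(1/\bar z)}$ is the reversed polynomial. If $d\mu$ is supported at exactly $N$ points, then $\alpha_0,\dots,\alpha_{N-2}\in\mathbb{D}$ and $\alpha_{N-1}\in S^1$; if the support is infinite, all $\alpha_k\in\mathbb{D}$. In both cases measures and coefficient sequences are in 1-1 correspondence. Thus $\Phi_n(z)=\Phi_n(z;\alpha_0,\dots,\alpha_{n-1})$ is a function of the Verblunsky coefficients, with $z\in\mathbb{C}$ a parameter. The second kind polynomials are $\Psi_n(z)=\Phi_n(z;-\alpha_0,\dots,-\alpha_{n-1})$, with reversed polynomials $\Psi_n^*(z)=z^n\,\overline{\Psi_n(1/\bar z)}$; so $\Psi_0=\Psi_0^*=1$, $\Psi_{k+1}(z)=z\Psi_k(z)+\bar\alpha_k\Psi_k^*(z)$, $\Psi_{k+1}^*(z)=\Psi_k^*(z)+\alpha_k z\Psi_k(z)$. Put $\rho_k=\sqrt{1-|\alpha_k|^2}$, and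 for $\alpha=u+iv$ use $\partial/\partial\alpha=\frac12(\partial_u-i\partial_v)$, $\partial/\partial\bar\alpha=\frac12(\partial_u+i\partial_v)$. Poisson brackets: in the finite case ($N$ support points), for smooth functions $f,g$ on $\mathbb{D}^{N-1}\times S^1$, $$\{f,g\}=i\sum_{k=0}^{N-2}\rho_k^2\left[\frac{\partial f}{\partial\bar\alpha_k}\frac{\partial g}{\partial\alpha_k}-\frac{\partial f}{\partial\alpha_k}\frac{\partial g}{\partial\bar\alpha_k}\right];$$ in the periodic case with (even) period $p$, for smooth $f,g$ on $\mathbb{D}^p=\{(\alpha_0,\dots,\alpha_{p-1}):\alpha_j\in\mathbb{D}\}$, the same formula with the sum running over $0\le k\le p-1$. *)

(* Defs.v *)
From HB Require Import structures.
From mathcomp Require Import all_boot all_order all_algebra complex.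
From mathcomp Require Import all_classical all_reals all_analysis.

Set Implicit Arguments.
Unset Strict Implicit.
Unset Printing Implicit Defensive.

Import Order.TTheory GRing.Theory Num.Theory.
Import numFieldNormedType.Exports.

Local Open Scope classical_set_scope.
Local Open Scope complex_scope.
Local Open Scope ring_scope.

(* [reversed k P] is z^k * conj (P (1 / conj z)) for P of degree at most k, as
   a polynomial: see [horner_reversed].  As usual for reversed polynomials, [k]
   is a parameter, not the degree of P. *)
Definition reversed (R : rcfType) (k : nat) (P : {poly R[i]}) : {poly R[i]} :=
  \poly_(i < k.+1) (P`_(k - i))^*.

Lemma horner_reversed (R : rcfType) (k : nat) (P : {poly R[i]}) (z : R[i]) :
  (size P <= k.+1)%N -> z != 0 ->
  (reversed k P).[z] = z ^+ k * (P.[(z^*)^-1])^*.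
Proof.
move=> sP z0; rewrite /reversed horner_poly (horner_coef_wide _ sP).
rewrite rmorph_sum mulr_sumr (reindex_inj rev_ord_inj) /=.
apply: eq_bigr => i _; have lei : (i <= k)%N by rewrite -ltnS ltn_ord.
rewrite subSS subKn // rmorphM rmorphXn fmorphV /= conjCK mulrCA; congr (_ * _).
by rewrite exprVn -expfB_cond // (negPf z0).
Qed.

(* The monic polynomial of degree k attached to the coefficients
   alpha 0, ..., alpha (k - 1); the other values of alpha are not read. *)
Fixpoint Phi (R : rcfType) (alpha : nat -> R[i]) (k : nat) : {poly R[i]} :=
  if k is k'.+1 then
    'X * Phi alpha k' - ((alpha k')^*)%:P * reversed k' (Phi alpha k')
  else 1.

Definition Phi_star (R : rcfType) (alpha : nat -> R[i]) (k : nat) :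
  {poly R[i]} := reversed k (Phi alpha k).

Definition Psi (R : rcfType) (alpha : nat -> R[i]) (k : nat) : {poly R[i]} :=
  Phi (fun j => - alpha j) k.

Definition Psi_star (R : rcfType) (alpha : nat -> R[i]) (k : nat) :
  {poly R[i]} := reversed k (Psi alpha k).

Lemma size_Phi (R : rcfType) (alpha : nat -> R[i]) (k : nat) :
  size (Phi alpha k) = k.+1.
Proof.
elim: k => [|k IHk] /=; first by rewrite size_poly1.
have P0 : Phi alpha k != 0 by rewrite -size_poly_eq0 IHk.
have sX : size ('X * Phi alpha k) = k.+2 by rewrite mulrC size_mulX ?IHk.
rewrite size_polyDl sX // size_polyN mul_polyC ltnS.
by apply: leq_trans (size_scale_leq _ _) (size_poly _ _).
Qed.

Lemma Phi_starS (R : rcfType) (alpha : nat -> R[i]) (k : nat) :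
  Phi_star alpha k.+1 =
  Phi_star alpha k - (alpha k)%:P * ('X * Phi alpha k).
Proof.
rewrite /Phi_star; apply/polyP => i.
rewrite [RHS]coefB coefCM coefXM ![(reversed _ _)`_i]coef_poly.
rewrite coefB coefXM coefCM coef_poly rmorphB rmorphM /= conjCK.
case: i => [|i] /=; first by rewrite !subn0 ltnn rmorph0 !mulr0.
rewrite !ltnS subSS; have [leik|ltki] := leqP i k; last first.
  rewrite (leq_gtF (ltnW ltki)) (nth_default 0 (s := Phi alpha k)) ?size_Phi //.
  by rewrite mulr0 subr0.
rewrite leq_subr subKn // conjCK subn_eq0 subnS.
by case: (ltnP i k) => // _; rewrite rmorph0.
Qed.

(* Borel probability measures on S^1 are taken as probability measures on the
   plane R * R, whose product sigma-algebra is the Borel one, giving mass 1 to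
   the unit circle. *)
Definition to_complex (R : rcfType) (x : R * R) : R[i] := x.1 +i* x.2.

Definition circle (R : rcfType) : set (R * R) :=
  [set x | `|to_complex x| = 1].

Definition measure_support (R : realType) (mu : probability (R * R)%type R) :
  set (R * R) :=
  [set x | forall U : set (R * R), open U -> U x -> (0 < mu U)%E].

Definition circle_integral (R : realType) (mu : probability (R * R)%type R)
    (f : R[i] -> R[i]) : R[i] :=
  Rintegral mu (@circle R) (fun x => complex.Re (f (to_complex x)))
  +i* Rintegral mu (@circle R) (fun x => complex.Im (f (to_complex x))).

Definition is_monic_OP (R : realType) (mu : probability (R * R)%type R)
    (k : nat) (P : {poly R[i]}) : Prop :=
  [/\ P \is monic, size P = k.+1 &
      forall Q : {poly R[i]}, (size Q <= k)%N ->
        circle_integral mu (fun z => (Q.[z])^* * P.[z]) = 0].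

(* alpha 0, ..., alpha (K - 1) are Verblunsky coefficients of mu.  If mu has
   exactly N support points, the monic orthogonal polynomials are unique up to
   degree N (the one of degree N vanishes on the support), so this is
   meaningful for K <= N. *)
Definition verblunsky_upto (R : realType) (mu : probability (R * R)%type R)
    (K : nat) (alpha : nat -> R[i]) : Prop :=
  exists P : nat -> {poly R[i]},
    (forall k, (k <= K)%N -> is_monic_OP mu k (P k)) /\
    (forall k, (k < K)%N ->
       P k.+1 = 'X * P k - ((alpha k)^*)%:P * reversed k (P k)).

Definition finite_case (R : realType) (mu : probability (R * R)%type R)
    (N : nat) (alpha : nat -> R[i]) : Prop :=
  (measure_support mu #= `I_N)%card /\ verblunsky_upto mu N alpha.

Definition has_period (T : Type) (a : nat -> T) (q : nat) : Prop :=
  forall k, a (k + q)%N = a k.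

Definition minimal_period (T : Type) (a : nat -> T) (p : nat) : Prop :=
  [/\ (0 < p)%N, has_period a p &
      forall q, (0 < q < p)%N -> ~ has_period a q].

Definition periodic_case (R : realType) (mu : probability (R * R)%type R)
    (p : nat) (alpha : nat -> R[i]) : Prop :=
  [/\ infinite_set (measure_support mu),
      forall K, verblunsky_upto mu K alpha,
      minimal_period alpha p & ~~ odd p].

Definition rho (R : rcfType) (a : R[i]) : R[i] := sqrtC (1 - `|a| ^+ 2).

(* Functions on the phase space (contained in C^M) are represented by functions
   of M complex coordinates.  Derivatives are taken only in coordinates that
   range over the open disk. *)
Definition shift_coord (R : rcfType) (M : nat) (a : 'I_M -> R[i]) (k : 'I_M)
    (h : R[i]) : 'I_M -> R[i] :=
  fun j => if j == k then a j + h else a j.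

(* Derivative at 0 of t |-> f (a + t v e_k), for real t. *)
Definition real_partial (R : realType) (M : nat) (v : R[i])
    (f : ('I_M -> R[i]) -> R[i]) (k : 'I_M) (a : 'I_M -> R[i]) : R[i] :=
  derive1 (fun t : R => complex.Re (f (shift_coord a k (t%:C * v)))) 0
  +i* derive1 (fun t : R => complex.Im (f (shift_coord a k (t%:C * v)))) 0.

Definition d_alpha (R : realType) (M : nat) (f : ('I_M -> R[i]) -> R[i])
    (k : 'I_M) (a : 'I_M -> R[i]) : R[i] :=
  2^-1 * (real_partial 1 f k a - 'i * real_partial 'i f k a).

Definition d_alphabar (R : realType) (M : nat) (f : ('I_M -> R[i]) -> R[i])
    (k : 'I_M) (a : 'I_M -> R[i]) : R[i] :=
  2^-1 * (real_partial 1 f k a + 'i * real_partial 'i f k a).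

Definition bracket_upto (R : realType) (m M : nat)
    (f g : ('I_M -> R[i]) -> R[i]) (a : 'I_M -> R[i]) : R[i] :=
  'i * \sum_(k < M | (k < m)%N) rho (a k) ^+ 2 *
         (d_alphabar f k a * d_alpha g k a - d_alpha f k a * d_alphabar g k a).

(* On D^(N-1) x S^1: the sum runs over 0 <= k <= N - 2. *)
Definition finite_bracket (R : realType) (N : nat) :=
  @bracket_upto R N.-1 N.

(* On D^p: the sum runs over 0 <= k <= p - 1. *)
Definition periodic_bracket (R : realType) (p : nat) :=
  @bracket_upto R p p.

(* Extension by 0 of a finite list of coefficients.  Only coefficients of index
   < n enter [Phi _ n], so the padding is irrelevant for n <= M. *)
Definition pad (R : rcfType) (M : nat) (a : 'I_M -> R[i]) (k : nat) : R[i] :=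
  if insub k is Some i then a i else 0.

(* For a family F of polynomials in the coefficients, F n z regarded as a
   function of the coefficients. *)
Definition coeff_fun (R : rcfType) (M : nat)
    (F : (nat -> R[i]) -> nat -> {poly R[i]}) (n : nat) (z : R[i]) :
    ('I_M -> R[i]) -> R[i] :=
  fun a => (F (pad a) n).[z].

(* Main.v *)
Require Import Defs.
From mathcomp Require Import all_boot all_order all_algebra complex.
From mathcomp Require Import all_classical all_reals all_analysis.
From mathcomp Require Import ring.
Import Order.TTheory GRing.Theory Num.Theory.
Import numFieldNormedType.Exports.
Local Open Scope ring_scope.

(** The pairs (Phi_n, Phi_n^* ) and (Psi_n, - Psi_n^* ) are both orbits of the
    Szego transfer matrices

      A(alpha, z) = [[z, - conj alpha], [- alpha z, 1]],

    started at (1, 1) and at (1, -1) ([szego_Phi], [szego_Psi]).  Put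
    T_n(z) = A(alpha_(n-1), z) ... A(alpha_0, z).  The only nonzero elementary
    bracket is {conj alpha_k, alpha_k} = i rho_k^2, and with it a single factor
    satisfies a Sklyanin relation

      {A(z) (x) A(w)} = [r, A(z) (x) A(w)],

    where r = i / (z - w) (w e_1 (x) e_2 - z e_2 (x) e_1) det is a constant
    matrix of rank one; here det (x (x) y) = x_1 y_2 - x_2 y_1.
    Different factors depend on different coefficients, hence Poisson commute,
    so by the Leibniz rule the commutators telescope along the product and
    {T_n(z) (x) T_n(w)} = [r, T_n(z) (x) T_n(w)].  Applying this to constant
    vectors u, v gives the bracket of any two orbits ([sklyanin]): the term
    with r on the left produces the Wronskian-like expression
    U_1(z) V_2(w) - U_2(z) V_1(w), and the term with r on the right is
    proportional to det (u (x) v).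

    The six formulas are instances.  When u = v that determinant vanishes, which
    gives the brackets within the Phi family and within the Psi family.  For
    u = (1, 1) and v = (1, -1) it equals -2 and the entries of T_n are the half
    sums and half differences of the two orbits, which is where the products
    (Phi - Psi)(Phi + Psi) and (Phi - Psi)(Phi^* - Psi^* ) come from.

    The Leibniz rule is applied to gradients: a function of M coefficients is
    replaced by the 2 x M matrix of its Wirtinger derivatives
    ([has_gradient]), on which the Poisson bracket is a bilinear alternating
    form ([poisson]); the rest of the argument is algebra at a fixed point of
    the phase space. *)

(** * Orbits of the Szego transfer matrices *)

Section Szego.
Set Implicit Arguments.
Unset Strict Implicit.
Variable R : rcfType.
Implicit Types (u v : R[i] * R[i]) (z w : R[i]) (alpha : nat -> R[i]).

Fixpoint szego u z alpha n : R[i] * R[i] :=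
  if n is n'.+1 then
    let U := szego u z alpha n' in
    (z * U.1 - (alpha n')^* * U.2, U.2 - alpha n' * (z * U.1))
  else u.

Lemma szego_Phi z alpha n :
  szego (1, 1) z alpha n = ((Phi alpha n).[z], (Phi_star alpha n).[z]).
Proof.
elim: n => [|n IH] /=.
  rewrite /Phi_star /reversed horner_poly big_ord_recr big_ord0 /=.
  by rewrite hornerC subnn coefC eqxx rmorph1 expr0 mulr1 add0r.
rewrite IH Phi_starS /Phi_star !(hornerD, hornerN, hornerM, hornerC, hornerX).
by congr pair; rewrite mulrC.
Qed.

(** Changing the sign of every coefficient conjugates the transfer matrices by
    diag (1, -1); this is why the second component is - Psi_n^*. *)
Lemma szego_Psi z alpha n :
  szego (1, -1) z alpha n = ((Psi alpha n).[z], - (Psi_star alpha n).[z]).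
Proof.
have [<- <-] :
    (szego (1, 1) z (fun j => - alpha j) n).1 = (Psi alpha n).[z] /\
    (szego (1, 1) z (fun j => - alpha j) n).2 = (Psi_star alpha n).[z].
  by rewrite szego_Phi.
elim: n => [//|n IH]; rewrite /= IH /= rmorphN /=.
by congr pair; ring.
Qed.

Lemma szego_linear u z alpha n :
  szego u z alpha n =
  (u.1 * (szego (1, 0) z alpha n).1 + u.2 * (szego (0, 1) z alpha n).1,
   u.1 * (szego (1, 0) z alpha n).2 + u.2 * (szego (0, 1) z alpha n).2).
Proof.
elim: n => [|n IH]; first by case: u => u1 u2 /=; congr pair; ring.
by rewrite /= IH /=; congr pair; ring.
Qed.

(** * The Poisson form on gradients *)

Section PoissonForm.
Variables (M m : nat) (alpha : nat -> R[i]).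
Implicit Types (P Q S X : 'M[R[i]]_(2, M)).

(** A gradient is a 2 x M matrix: column k holds the derivative with respect
    to alpha_k in row 0, and with respect to conj alpha_k in row 1. *)
Definition dalpha n : 'M[R[i]]_(2, M) :=
  \matrix_(i, k) ((i == 0) && (k == n :> nat))%:R.

Definition dalphabar n : 'M[R[i]]_(2, M) :=
  \matrix_(i, k) ((i == 1) && (k == n :> nat))%:R.

(** The recursion defining [szego], differentiated by the Leibniz rule;
    [szego_gradient] proves that these are gradients. *)
Fixpoint dszego u z n : 'M[R[i]]_(2, M) * 'M[R[i]]_(2, M) :=
  if n is n'.+1 then
    let U := szego u z alpha n' in
    let dU := dszego u z n' in
    (z *: dU.1 - ((alpha n')^* *: dU.2 + U.2 *: dalphabar n'),
     dU.2 - ((alpha n' * z) *: dU.1 + (z * U.1) *: dalpha n'))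
  else (0, 0).

Definition poisson P Q : R[i] :=
  'i * \sum_(k < M | (k < m)%N) (1 - `|alpha k| ^+ 2) *
         (P 1 k * Q 0 k - P 0 k * Q 1 k).

Lemma poissonC P Q : poisson P Q = - poisson Q P.
Proof.
rewrite /poisson -mulrN -sumrN; congr (_ * _); apply: eq_bigr => k _.
ring.
Qed.

Lemma poissonDl P1 P2 Q : poisson (P1 + P2) Q = poisson P1 Q + poisson P2 Q.
Proof.
rewrite /poisson -mulrDr -big_split; congr (_ * _); apply: eq_bigr => k _ /=.
by rewrite !mxE; ring.
Qed.

Lemma poissonZl c P Q : poisson (c *: P) Q = c * poisson P Q.
Proof.
rewrite /poisson mulrCA; congr (_ * _); rewrite mulr_sumr.
by apply: eq_bigr => k _ /=; rewrite !mxE; ring.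
Qed.

Lemma poissonZr c P Q : poisson P (c *: Q) = c * poisson P Q.
Proof. by rewrite poissonC poissonZl -mulrN -poissonC. Qed.

Lemma poissonNl P Q : poisson (- P) Q = - poisson P Q.
Proof. by rewrite -scaleN1r poissonZl mulN1r. Qed.

Lemma poissonNr P Q : poisson P (- Q) = - poisson P Q.
Proof. by rewrite poissonC poissonNl -poissonC. Qed.

(** Both components of the recursion for [dszego] have this shape. *)
Lemma poisson_linl b c P Q S X :
  poisson (P - (b *: Q + c *: S)) X =
  poisson P X - (b * poisson Q X + c * poisson S X).
Proof. by rewrite poissonDl poissonNl poissonDl 2!poissonZl. Qed.

Lemma poisson_linr b c P Q S X :
  poisson X (P - (b *: Q + c *: S)) =
  poisson X P - (b * poisson X Q + c * poisson X S).
Proof. by rewrite poissonC poisson_linl 3!(poissonC _ X); ring. Qed.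

Lemma poisson_dalpha n :
  poisson (dalpha n) (dalpha n) = 0 /\
  poisson (dalphabar n) (dalphabar n) = 0.
Proof.
by split; rewrite /poisson big1 ?mulr0 // => k _; rewrite !mxE /=; ring.
Qed.

Lemma poisson_dalphabar_dalpha n : (n < m)%N -> (n < M)%N ->
  poisson (dalphabar n) (dalpha n) = 'i * (1 - alpha n * (alpha n)^*).
Proof.
move=> nm nM; rewrite /poisson (bigD1 (Ordinal nM)) //= big1 => [|k /andP[_ nk]].
  by rewrite !mxE /= eqxx /= normCK; ring.
rewrite !mxE -[n]/(nat_of_ord (Ordinal nM)) (inj_eq val_inj) (negPf nk) !andbF.
by rewrite /=; ring.
Qed.

Lemma dszego_future u z n (i : 'I_2) (k : 'I_M) : (n <= k)%N ->
  (dszego u z n).1 i k = 0 /\ (dszego u z n).2 i k = 0.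
Proof.
elim: n => [|n IH] lenk /=; first by rewrite !mxE.
have [e1 e2] := IH (ltnW lenk).
by rewrite !mxE e1 e2 (gtn_eqF lenk) !andbF !mulr0 addr0 subr0.
Qed.

Lemma poisson_disjoint (n : nat) P Q :
    (forall i (k : 'I_M), (n <= k)%N -> P i k = 0) ->
    (forall i (k : 'I_M), (k < n)%N -> Q i k = 0) ->
  poisson P Q = 0.
Proof.
move=> P0 Q0; rewrite /poisson big1 ?mulr0 // => k _.
by have [kn|nk] := ltnP k n; [rewrite !Q0 //|rewrite !P0 //]; ring.
Qed.

(** The orbit at time n only involves coefficients of index below n, so it
    Poisson commutes with alpha_n and its conjugate: the next transfer matrix
    is independent of the product of the earlier ones. *)
Lemma poisson_future u z n :
  [/\ poisson (dszego u z n).1 (dalpha n) = 0,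
      poisson (dszego u z n).2 (dalpha n) = 0,
      poisson (dszego u z n).1 (dalphabar n) = 0 &
      poisson (dszego u z n).2 (dalphabar n) = 0].
Proof.
split; apply: (@poisson_disjoint n) => i k hk;
  by [case: (dszego_future u z i hk)|rewrite mxE (ltn_eqF hk) andbF].
Qed.

(** * The Sklyanin bracket of two orbits *)

(** With E and F the two columns of the transfer matrix T_n, these are the four
    components of r (U (x) V) - (T_n(z) (x) T_n(w)) r (u (x) v).  In the
    inductive step the Leibniz rule gives two parts.  The brackets of the
    previous stage are multiplied by A(z) (x) A(w), which turns the second term
    into its successor but puts A(z) (x) A(w) on the left of r in the first.
    The bracket {conj alpha_n, alpha_n} moves r back to the left: it adds
    {A(z) (x) A(w)} = r (A(z) (x) A(w)) - (A(z) (x) A(w)) r, applied to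
    U (x) V, whose nonzero components are the two mixed ones. *)
Lemma sklyanin u v z w n : z != w -> (n <= m)%N -> (n <= M)%N ->
  let U := szego u z alpha n in let V := szego v w alpha n in
  let dU := dszego u z n in let dV := dszego v w n in
  let Ez := szego (1, 0) z alpha n in let Ew := szego (1, 0) w alpha n in
  let Fz := szego (0, 1) z alpha n in let Fw := szego (0, 1) w alpha n in
  let W := U.1 * V.2 - U.2 * V.1 in
  let d := u.1 * v.2 - u.2 * v.1 in
  let c := 'i / (z - w) in
  [/\ poisson dU.1 dV.1 = c * (- d * (w * Ez.1 * Fw.1 - z * Fz.1 * Ew.1)),
      poisson dU.1 dV.2 =
        c * (w * W - d * (w * Ez.1 * Fw.2 - z * Fz.1 * Ew.2)),
      poisson dU.2 dV.1 =
        c * (- z * W - d * (w * Ez.2 * Fw.1 - z * Fz.2 * Ew.1)) &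
      poisson dU.2 dV.2 = c * (- d * (w * Ez.2 * Fw.2 - z * Fz.2 * Ew.2))].
Proof.
rewrite -subr_eq0 => zw; elim: n => [|n IH] nm nM.
  have p0 P : poisson 0 P = 0 by rewrite -(scale0r 0) poissonZl mul0r.
  by rewrite /= !p0; split; ring.
move: (IH (ltnW nm) (ltnW nM)) => /= [].
have [u1 u2 u3 u4] := poisson_future u z n.
have flip P Q : poisson P Q = 0 -> poisson Q P = 0.
  by rewrite (poissonC Q) => ->; rewrite oppr0.
have [/flip v1 /flip v2 /flip v3 /flip v4] := poisson_future v w n.
have [s1 s2] := poisson_dalpha n.
have s3 := poisson_dalphabar_dalpha nm nM.
have s4 :
    poisson (dalpha n) (dalphabar n) = - ('i * (1 - alpha n * (alpha n)^*)).
  by rewrite poissonC s3.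
move: (dszego u z n) (dszego v w n) (dalpha n) (dalphabar n)
  u1 u2 u3 u4 v1 v2 v3 v4 s1 s2 s3 s4.
move=> [P1 P2] [Q1 Q2] X Y /= u1 u2 u3 u4 v1 v2 v3 v4 s1 s2 s3 s4.
rewrite !poisson_linl !poissonZl !poisson_linr !poissonZr.
rewrite u1 u2 u3 u4 v1 v2 v3 v4 s1 s2 s3 s4.
move=> -> -> -> ->.
(* Writing 'i as c * (z - w) turns the goals into polynomial identities. *)
pose c := 'i / (z - w).
have iE : 'i = c * (z - w) by rewrite mulfVK.
rewrite -!['i / _]/(c) iE; move: c {iE} => c.
move: (szego u z alpha n) (szego v w alpha n) (szego (1, 0) z alpha n)
  (szego (0, 1) z alpha n) (szego (1, 0) w alpha n) (szego (0, 1) w alpha n).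
move: ((alpha n)^*) (alpha n).
move=> b a [U1 U2] [V1 V2] [E1 E2] [F1 F2] [E3 E4] [F3 F4].
split; ring.
Qed.

End PoissonForm.
End Szego.

(** * Wirtinger gradients *)

Section Gradient.
Set Implicit Arguments.
Unset Strict Implicit.
Variable R : realType.

Definition has_curve_derivative (f : R -> R[i]) (d : R[i]) : Prop :=
  is_derive (0 : R) (1 : R) (fun t => complex.Re (f t)) (complex.Re d) /\
  is_derive (0 : R) (1 : R) (fun t => complex.Im (f t)) (complex.Im d).

Lemma ReM (x y : R[i]) : complex.Re (x * y) =
  complex.Re x * complex.Re y - complex.Im x * complex.Im y.
Proof. by case: x; case: y. Qed.

Lemma ImM (x y : R[i]) : complex.Im (x * y) =
  complex.Re x * complex.Im y + complex.Im x * complex.Re y.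
Proof. by case: x; case: y. Qed.

Lemma has_curve_derivative_cst c : has_curve_derivative (fun=> c) 0.
Proof. by split; exact: is_derive_cst. Qed.

Lemma has_curve_derivativeB f g df dg :
  has_curve_derivative f df -> has_curve_derivative g dg ->
  has_curve_derivative (fun t => f t - g t) (df - dg).
Proof.
move=> [f1 f2] [g1 g2]; rewrite /has_curve_derivative !raddfB /=; split.
  have := is_deriveB f1 g1; congr (is_derive _ _ _ _).
  by apply/funext => t; rewrite raddfB.
have := is_deriveB f2 g2; congr (is_derive _ _ _ _).
by apply/funext => t; rewrite raddfB.
Qed.

Lemma has_curve_derivativeM f g df dg :
  has_curve_derivative f df -> has_curve_derivative g dg ->
  has_curve_derivative (fun t => f t * g t) (df * g 0 + f 0 * dg).
Proof.
move=> [f1 f2] [g1 g2]; rewrite /has_curve_derivative; split.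
  have := is_deriveB (is_deriveM f1 g1) (is_deriveM f2 g2).
  congr (is_derive _ _ _ _); first by apply/funext => t; rewrite ReM.
  by rewrite (raddfD (@complex.Re R)) /= !ReM /GRing.scale /=; ring.
have := is_deriveD (is_deriveM f1 g2) (is_deriveM f2 g1).
congr (is_derive _ _ _ _); first by apply/funext => t; rewrite ImM.
by rewrite (raddfD (@complex.Im R)) /= !ImM /GRing.scale /=; ring.
Qed.

Lemma has_curve_derivative_line c v :
  has_curve_derivative (fun t => c + t%:C%C * v) v.
Proof.
have aff (x y : R) : is_derive (0 : R) (1 : R) (fun t => x + t * y) y.
  have := is_deriveD (is_derive_cst x (0 : R) (1 : R))
    (is_deriveM (is_derive_id (0 : R) (1 : R)) (is_derive_cst y (0 : R) (1 : R))).
  by congr (is_derive _ _ _ _); rewrite /GRing.scale /=; ring.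
case: c v => [c1 c2] [v1 v2]; split => /=.
  have := aff c1 v1; congr (is_derive _ _ _ _).
  by apply/funext => t; rewrite mul0r subr0.
have := aff c2 v2; congr (is_derive _ _ _ _).
by apply/funext => t; rewrite mul0r addr0.
Qed.

Lemma has_curve_derivative_conj (f : R -> R[i]) d :
  has_curve_derivative f d -> has_curve_derivative (fun t => (f t)^*) d^*.
Proof.
have ReJ (x : R[i]) : complex.Re x^* = complex.Re x by case: x.
have ImJ (x : R[i]) : complex.Im x^* = - complex.Im x by case: x.
move=> [f1 f2]; rewrite /has_curve_derivative ReJ ImJ; split.
  have := f1; congr (is_derive _ _ _ _).
  by apply/funext => t; rewrite ReJ.
have := is_deriveN f2; congr (is_derive _ _ _ _).
by apply/funext => t; rewrite ImJ.
Qed.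

Variable M : nat.
Implicit Types (f g : ('I_M -> R[i]) -> R[i]) (a : 'I_M -> R[i]).

(** The derivative in every real direction v of the k-th coordinate is
    (df/dalpha_k) v + (df/dconj alpha_k) conj v.  Asking for all directions v,
    rather than for the two used by [d_alpha], makes the product rule and the
    conjugation rule immediate. *)
Definition has_gradient f a (P : 'M[R[i]]_(2, M)) : Prop :=
  forall k v, has_curve_derivative (fun t => f (shift_coord a k (t%:C%C * v)))
    (P 0 k * v + P 1 k * v^*).

Lemma has_gradient_cst c a : has_gradient (fun=> c) a 0.
Proof.
by move=> k v; rewrite !mxE !mul0r addr0; exact: has_curve_derivative_cst.
Qed.

Lemma has_gradientB f g a P Q : has_gradient f a P -> has_gradient g a Q ->
  has_gradient (fun b => f b - g b) a (P - Q).
Proof.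
move=> Pf Qg k v; have := has_curve_derivativeB (Pf k v) (Qg k v).
by congr has_curve_derivative; rewrite !mxE; ring.
Qed.

Lemma has_gradientN f a P :
  has_gradient f a P -> has_gradient (fun b => - f b) a (- P).
Proof.
move=> Pf; have := has_gradientB (has_gradient_cst 0 a) Pf.
by congr has_gradient; [apply/funext => b|]; rewrite sub0r.
Qed.

Lemma has_gradientM f g a P Q : has_gradient f a P -> has_gradient g a Q ->
  has_gradient (fun b => f b * g b) a (f a *: Q + g a *: P).
Proof.
move=> Pf Qg k v; have := has_curve_derivativeM (Pf k v) (Qg k v).
have -> : shift_coord a k (0%:C%C * v) = a.
  by apply/funext => j; rewrite /shift_coord mul0r addr0; case: eqP.
by congr has_curve_derivative; rewrite !mxE; ring.
Qed.

Lemma pad_ord a (k : 'I_M) : pad a k = a k.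
Proof. by rewrite /pad valK. Qed.

Lemma pad_curve a n (k : 'I_M) v : (n < M)%N ->
  has_curve_derivative (fun t => pad (shift_coord a k (t%:C%C * v)) n)
    ((k == n :> nat)%:R * v).
Proof.
move=> nM; have padE (b : 'I_M -> R[i]) : pad b n = b (Ordinal nM) by rewrite -(pad_ord b (Ordinal nM)).
have -> : (k == n :> nat) = (Ordinal nM == k) by rewrite eq_sym.
case: (eqVneq (Ordinal nM) k) => [nk|/negPf nk].
  have := has_curve_derivative_line (pad a n) v; rewrite mul1r.
  congr has_curve_derivative; apply/funext => t.
  by rewrite !padE /shift_coord nk eqxx.
have := has_curve_derivative_cst (pad a n); rewrite mul0r.
congr has_curve_derivative; apply/funext => t.
by rewrite !padE /shift_coord nk.
Qed.

Lemma has_gradient_pad a n : (n < M)%N ->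
  has_gradient (fun b => pad b n) a (dalpha R M n).
Proof.
move=> nM k v; have := pad_curve a k v nM.
by congr has_curve_derivative; rewrite !mxE /=; ring.
Qed.

Lemma has_gradient_pad_conj a n : (n < M)%N ->
  has_gradient (fun b => (pad b n)^*) a (dalphabar R M n).
Proof.
move=> nM k v; have := has_curve_derivative_conj (pad_curve a k v nM).
by congr has_curve_derivative; rewrite !mxE rmorphM rmorph_nat /=; ring.
Qed.

Lemma szego_gradient u z a n : (n <= M)%N ->
  has_gradient (fun b => (szego u z (pad b) n).1) a
    (dszego M (pad a) u z n).1 /\
  has_gradient (fun b => (szego u z (pad b) n).2) a
    (dszego M (pad a) u z n).2.
Proof.
elim: n => [|n IH] nM; first by split; exact: has_gradient_cst.
have [g1 g2] := IH (ltnW nM) => /=.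
have gz := has_gradientM (has_gradient_cst z a) g1.
split.
  have := has_gradientB gz (has_gradientM (has_gradient_pad_conj a nM) g2).
  by congr has_gradient; rewrite scaler0 addr0.
have := has_gradientB g2 (has_gradientM (has_gradient_pad a nM) gz).
by congr has_gradient; rewrite scaler0 addr0 scalerA.
Qed.

Lemma wirtingerE f a P k : has_gradient f a P ->
  d_alpha f k a = P 0 k /\ d_alphabar f k a = P 1 k.
Proof.
move=> Pf.
have dE v : real_partial v f k a = P 0 k * v + P 1 k * v^*.
  have [h1 h2] := Pf k v; rewrite /real_partial !derive1E.
  by rewrite (@derive_val _ _ _ _ _ _ _ h1) (@derive_val _ _ _ _ _ _ _ h2);
     case: (_ + _).
have half (x : R[i]) : 2^-1 * (x + x) = x by field.
have iz (x y : R[i]) : 'i * (x * 'i - y * 'i) = y - x.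
  by rewrite -mulrBl mulrCA -expr2 sqrCi mulrN1 opprB.
rewrite /d_alpha /d_alphabar !dE !mulr1 rmorph1 mulr1.
rewrite conjCi !mulrN iz.
by split; rewrite -[RHS]half; congr (_ * _); ring.
Qed.

Lemma bracketE m f g a P Q : has_gradient f a P -> has_gradient g a Q ->
  bracket_upto m f g a = poisson m (pad a) P Q.
Proof.
move=> Pf Qg; rewrite /bracket_upto /poisson; congr (_ * _).
apply: eq_bigr => k _.
have [-> ->] := wirtingerE k Pf; have [-> ->] := wirtingerE k Qg.
by rewrite /rho sqrtCK pad_ord.
Qed.

End Gradient.

Theorem theorem1 (R : realType) (mu : probability (R * R)%type R)
    (hmu : mu (@circle R) = 1%E)
    (n M : nat) (hM : (n.+1 <= M)%N)
    (alpha : nat -> R[i])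
    (br : (('I_M -> R[i]) -> R[i]) -> (('I_M -> R[i]) -> R[i]) ->
          ('I_M -> R[i]) -> R[i])
    (hcase : (finite_case mu M alpha /\ br = @finite_bracket R M) \/
             (periodic_case mu M alpha /\ br = @periodic_bracket R M))
    (z w : R[i]) (hzw : z <> w) :
  let a : 'I_M -> R[i] := fun k => alpha k in
  let Phin := coeff_fun (M := M) (@Phi R) n in
  let Phins := coeff_fun (M := M) (@Phi_star R) n in
  let Psin := coeff_fun (M := M) (@Psi R) n in
  let Psins := coeff_fun (M := M) (@Psi_star R) n in
  br (Phin z) (Phin w) a = 0 /\
  br (Psin z) (Psin w) a = 0 /\
  br (Phin z) (Phins w) a =
    'i * w / (z - w) * (Phin z a * Phins w a - Phin w a * Phins z a) /\
  br (Psin z) (Psins w) a =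
    'i * w / (z - w) * (Psin z a * Psins w a - Psin w a * Psins z a) /\
  br (Phin z) (Psin w) a =
    - 'i * w / (z - w) * (Phin z a * Psin w a - Phin w a * Psin z a)
    - 'i / 2 * (Phin z a - Psin z a) * (Phin w a + Psin w a) /\
  br (Phin z) (Psins w) a =
    - 'i * w / (z - w) * (Psin z a * Phins w a - Psin w a * Phins z a)
    + 'i / 2 * (Phin z a - Psin z a) * (Phins w a - Psins w a).
Proof.
move=> a Phin Phins Psin Psins.
(* In both cases the bracket sums over at least the first n coefficients. *)
have [m nm ->] : exists2 m, (n <= m)%N & br = @bracket_upto R m M.
  case: hcase => [[_ ->]|[_ ->]]; last by exists M => //; exact: ltnW.
  by exists M.-1; rewrite // -ltnS (ltn_predK hM).
have {hM} nM := ltnW hM; move/eqP: hzw => zw.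
pose dPhi x := dszego M (pad a) (1, 1) x n.
pose dPsi x := dszego M (pad a) (1, -1) x n.
have gPhi x : has_gradient (Phin x) a (dPhi x).1.
  have [+ _] := szego_gradient (1, 1) x a nM.
  by congr has_gradient; apply/funext => b; rewrite szego_Phi.
have gPhis x : has_gradient (Phins x) a (dPhi x).2.
  have [_] := szego_gradient (1, 1) x a nM.
  by congr has_gradient; apply/funext => b; rewrite szego_Phi.
have gPsi x : has_gradient (Psin x) a (dPsi x).1.
  have [+ _] := szego_gradient (1, -1) x a nM.
  by congr has_gradient; apply/funext => b; rewrite szego_Psi.
have gPsis x : has_gradient (Psins x) a (- (dPsi x).2).
  have [_ /has_gradientN] := szego_gradient (1, -1) x a nM.
  by congr has_gradient; apply/funext => b; rewrite szego_Psi opprK.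
pose E x := szego (1, 0) x (pad a) n; pose F x := szego (0, 1) x (pad a) n.
have [PhiE PhisE] : (forall x, Phin x a = (E x).1 + (F x).1) /\
    (forall x, Phins x a = (E x).2 + (F x).2).
  by split=> x; have := szego_linear (1, 1) x (pad a) n;
     rewrite szego_Phi /= !mul1r => -[].
have [PsiE PsisE] : (forall x, Psin x a = (E x).1 - (F x).1) /\
    (forall x, Psins x a = (F x).2 - (E x).2).
  split=> x; have := szego_linear (1, -1) x (pad a) n;
    rewrite szego_Psi /= !mul1r !mulN1r => -[] // _.
  by move=> /(congr1 -%R); rewrite opprK opprB.
have zw0 : z - w != 0 by rewrite subr_eq0.
rewrite (bracketE m (gPhi z) (gPhi w)) (bracketE m (gPsi z) (gPsi w)).
rewrite (bracketE m (gPhi z) (gPhis w)) (bracketE m (gPsi z) (gPsis w)).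
rewrite (bracketE m (gPhi z) (gPsi w)) (bracketE m (gPhi z) (gPsis w)).
rewrite !poissonNr.
have [-> -> _ _] := sklyanin (pad a) (1, 1) (1, 1) zw nm nM.
have [-> -> _ _] := sklyanin (pad a) (1, -1) (1, -1) zw nm nM.
have [-> -> _ _] := sklyanin (pad a) (1, 1) (1, -1) zw nm nM.
rewrite (szego_linear (1, 1) z) (szego_linear (1, 1) w).
rewrite (szego_linear (1, -1) z) (szego_linear (1, -1) w).
rewrite -!/(E _) -!/(F _) !PhiE !PhisE !PsiE !PsisE /=.
move: (E z) (E w) (F z) (F w) => [E1 E2] [E3 E4] [F1 F2] [F3 F4] /=.
by do 5?split; field.
Qed.
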